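(* Let $\mathcal{X}=\mathcal{X}(x,y)$ and $\mathcal{Y}=\mathcal{Y}(x,y)$ be $\mathcal{C}^\infty$-smooth functions of $(x,y)\in\mathbb{K}^2$, and let $\mathbf{Y}_1,\mathbf{Y}_2,\dots$ be the coefficients of the prolongations of the vector field $\mathcal{X}\,\frac{\partial}{\partial x}+\mathcal{Y}\,\frac{\partial}{\partial y}$, as defined in the context. For every integer $\kappa\geq 1$, $$ \begin{aligned} \mathbf{Y}_\kappa &=\mathcal{Y}_{x^\kappa} +\sum_{d=1}^{\kappa+1}\ \sum_{1\leq\lambda_1<\cdots<\lambda_d\leq\kappa}\ \sum_{\substack{\mu_1\geq 1,\dots,\mu_d\geq 1\\ \mu_1\lambda_1+\cdots+\mu_d\lambda_d\leq\kappa+1}}\\ &\quad\Bigg[ \frac{\kappa(\kappa-1)\cdots(\kappa-\mu_1\lambda_1-\cdots-\mu_d\lambda_d+1)}{(\lambda_1!)^{\mu_1}\,\mu_1!\cdots(\lambda_d!)^{\mu_d}\,\mu_d!}\; \mathcal{Y}_{x^{\kappa-\mu_1\lambda_1-\cdots-\mu_d\lambda_d}\,y^{\mu_1+\cdots+\mu_d}}\\ &\quad- \frac{\kappa(\kappa-1)\cdots(\kappa-\mu_1\lambda_1-\cdots-\mu_d\lambda_d+2)\,(\mu_1\lambda_1+\cdots+\mu_d\lambda_d)}{(\lambda_1!)^{\mu_1}\,\mu_1!\cdots(\lambda_d!)^{\mu_d}\,\mu_d!}\; \mathcal{X}_{x^{\kappa-\mu_1\lambda_1-\cdots-\mu_d\lambda_d+1}\,y^{\mu_1+\cdots+\mu_d-1}}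 \Bigg]\\ &\quad\cdot(y_{\lambda_1})^{\mu_1}\cdots(y_{\lambda_d})^{\mu_d}. \end{aligned} $$
   Context: $\mathbb{K}=\mathbb{R}$ or $\mathbb{C}$. There is one independent variable $x$ and one dependent variable $y$. The jet variables $x,y,y_1,y_2,\dots,y_\kappa$ are independent coordinates ($y_\lambda$ corresponds to $d^\lambda y/dx^\lambda$). For $\lambda\geq 1$ the total differentiation operator is $$D^\lambda:=\frac{\partial}{\partial x}+y_1\frac{\partial}{\partial y}+y_2\frac{\partial}{\partial y_1}+\cdots+y_\lambda\frac{\partial}{\partial y_{\lambda-1}}.$$ The $\kappa$-th prolongation of $\mathcal{X}\,\partial_x+\mathcal{Y}\,\partial_y$ to the $\kappa$-th jet space is $\mathcal{X}\,\partial_x+\mathcal{Y}\,\partial_y+\mathbf{Y}_1\,\partial_{y_1}+\cdots+\mathbf{Y}_\kappa\,\partial_{y_\kappa}$, with coefficients defined inductively by $$\mathbf{Y}_1:=D^1(\mathcal{Y})-D^1(\mathcal{X})\,y_1,\qquad \mathbf{Y}_\lambda:=D^\lambda(\mathbf{Y}_{\lambda-1})-D^1(\mathcal{X})\,y_\lambda\quad(\lambda\geq 2).$$ Notation: $\mathcal{Y}_{x^a y^b}:=\partial^{a+b}\mathcal{Y}/\partial x^a\partial y^b$, and similarly for $\mathcal{X}$. The $\lambda_i,\mu_i$ are integers. Writing $M:=\mu_1\lambda_1+\cdots+\mu_d\lambda_d$, the product $\kappa(\kappa-1)\cdots(\kappa-M+1)$ has $M$ factors and $\kappa(\kappa-1)\cdots(\kappa-M+2)$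 has $M-1$ factors (equal to $1$ if $M=1$). When $M=\kappa+1$ the first product contains the factor $0$ and the corresponding term in $\mathcal{Y}$ is understood to be $0$. *)

(* Defs.v *)
From HB Require Import structures.
From mathcomp Require Import all_boot all_order all_algebra.
From mathcomp Require Import all_classical all_reals all_analysis.
From mathcomp Require Import complex.

Set Implicit Arguments.
Unset Strict Implicit.
Unset Printing Implicit Defensive.

Import Order.TTheory GRing.Theory Num.Theory.
Import numFieldNormedType.Exports.

Local Open Scope classical_set_scope.
Local Open Scope ring_scope.
Local Open Scope complex_scope.

(* Since realType is the (unique up to isomorphism) complete archimedean
   ordered field, this says that K is the field of real numbers or the field
   of complex numbers. *)
Inductive real_or_complex : numFieldType -> Prop :=
| real_case (R : realType) : real_or_complex R
| complex_case (R : realType) : real_or_complex R[i].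

Section PlaneFunctions.
Variable K : numFieldType.
Implicit Type f : K * K -> K.

Definition dirx : K * K := (1, 0).
Definition diry : K * K := (0, 1).

(* Partial derivatives over K: for K = R[i] these are complex derivatives. *)
Definition pdx f : K * K -> K := 'D_dirx f.
Definition pdy f : K * K -> K := 'D_diry f.

(* f_{x^a y^b} *)
Definition pdxy (a b : nat) f : K * K -> K := iter a pdx (iter b pdy f).

(* The library's limit operator is total, so existence of the partial
   derivatives has to be required explicitly. *)
Fixpoint Ck (n : nat) f : Prop :=
  continuous f /\
  match n with
  | 0 => True
  | m.+1 => [/\ forall p, derivable f p dirx, forall p, derivable f p diry,
                Ck m (pdx f) & Ck m (pdy f)]
  end.

Definition smooth f : Prop := forall n, Ck n f.

End PlaneFunctions.

Section Jets.
Variable K : numFieldType.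

(* Jet space of order k, with coordinates (x, (y, y_1, ..., y_k)); the entry
   of index 0 of the row vector is y itself. *)
Definition jet (k : nat) : Type := (K * 'rV[K]_k.+1)%type.

Definition jx k (z : jet k) : K := z.1.
Definition jy k (z : jet k) (i : 'I_k.+1) : K := z.2 0 i.

Definition jet_proj (m k : nat) (le_mk : (m <= k)%N) (z : jet k) : jet m :=
  (jx z, \row_(i < m.+1) jy z (widen_ord (le_mk : (m.+1 <= k.+1)%N) i)).

Definition jet_of_plane (f : K * K -> K) (z : jet 0) : K := f (jx z, jy z ord0).

Definition jdx k (F : jet k -> K) (z : jet k) : K :=
  'D_((1, 0) : K * 'rV[K]_k.+1) F z.

Definition jdy k (i : 'I_k.+1) (F : jet k -> K) (z : jet k) : K :=
  'D_((0, delta_mx 0 i) : K * 'rV[K]_k.+1) F z.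

(* The operator D^{k+1}; [lift ord0 i] is the index i + 1. *)
Definition total_diff k (F : jet k -> K) (z : jet k.+1) : K :=
  let z' := jet_proj (leqnSn k) z in
  jdx F z' + \sum_(i < k.+1) jy z (lift ord0 i) * jdy i F z'.

(* prolong X Y k is the coefficient of d/dy_k in the prolongation of
   X d/dx + Y d/dy; starting the recursion at order 0 with Y itself gives
   D^1(Y) - D^1(X) y_1 at order 1. *)
Fixpoint prolong (X Y : K * K -> K) (k : nat) : jet k -> K :=
  match k return jet k -> K with
  | 0 => jet_of_plane Y
  | m.+1 => fun z =>
      total_diff (prolong X Y (k := m)) z
      - total_diff (jet_of_plane X) (jet_proj (ltn0Sn m) z) * jy z ord_max
  end.

End Jets.

Arguments prolong {K} X Y k z.

(* 1 <= l_1 < ... < l_d *)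
Definition increasing_pos (d n : nat) (l : {ffun 'I_d -> 'I_n}) : bool :=
  [forall i, (1 <= l i)%N] && [forall i : 'I_d, forall j : 'I_d, (i < j)%N ==> (l i < l j)%N].

Definition all_pos (d n : nat) (m : {ffun 'I_d -> 'I_n}) : bool :=
  [forall i, (1 <= m i)%N].

Definition wsum (d n p : nat)
  (l : {ffun 'I_d -> 'I_n}) (m : {ffun 'I_d -> 'I_p}) : nat :=
  (\sum_(i < d) m i * l i)%N.

Definition sum_mults (d p : nat) (m : {ffun 'I_d -> 'I_p}) : nat :=
  (\sum_(i < d) m i)%N.

Definition denom (d n p : nat)
  (l : {ffun 'I_d -> 'I_n}) (m : {ffun 'I_d -> 'I_p}) : nat :=
  (\prod_(i < d) ((l i)`! ^ m i * (m i)`!))%N.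

(* Main.v *)
(* Let g(t) = sum_(i >= 1) y_i t^i / i! be the formal Taylor expansion of
   y(x + t) - y(x). The total derivative maps g to g' - y_1, so if it maps h(t)
   to h'(t), then it maps the coefficient of t^k / k! in
   h(t) F(x + t, y + g(t)) to that of t^(k+1) / (k+1)!: the terms in y_1
   telescope. Taking h = 1 for Y and h = g' for X, with g cut at degree k, gives
   by induction a closed form of the k-th prolongation coefficient; the cut of
   g' produces exactly the correction - D(X) y_(k+1) of the recursion.
   Expanding the powers of g by the multinomial theorem yields a sum over
   functions j |-> mu_j from {1, ..., k} to the naturals, and such a function
   with support {l_1 < ... < l_d} is the same thing as the data (l, mu).
   The derivation property uses Schwarz's theorem; for K = C it is obtained by
   restricting the real and imaginary parts to real increments. *)

Require Import Defs.
From mathcomp Require Import all_boot all_order all_algebra.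
From mathcomp Require Import all_classical all_reals all_analysis.
From mathcomp Require Import complex ring lra.
Import Order.TTheory GRing.Theory Num.Theory numFieldNormedType.Exports.
Set Implicit Arguments.
Unset Strict Implicit.
Unset Printing Implicit Defensive.

Local Open Scope ring_scope.

(** * Symmetry of mixed partial derivatives *)
Lemma mvt_increment (R : realType) (f df : R -> R) (h : R) :
  0 < h -> (forall s, is_derive s (1 : R) f (df s)) ->
  exists2 c, `|c| <= h & f h - f 0 = df c * h.
Proof.
move=> h0 fdf.
have [c cin E] := @MVT_segment R f df 0 h (ltW h0) (fun x _ => fdf x)
  (derivable_within_continuous (fun x _ => @ex_derive _ _ _ _ _ _ _ (fdf x))).
exists c; last by rewrite E subr0.
by move: cin; rewrite in_itv /= => /andP[c0 ch]; rewrite ger0_norm.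
Qed.

(** The second difference F(h,h) - F(h,0) - F(0,h) + F(0,0) is h^2 times a value of [Fxy] and also
    h^2 times a value of [Fyx], by the mean value theorem in each variable, taken in either order.
    Continuity then brings this common value close to both values at the origin. *)
Lemma schwarz_real (R : realType) (F Fx Fy Fxy Fyx : R -> R -> R) :
  (forall s t, is_derive s (1 : R) (F^~ t) (Fx s t)) ->
  (forall s t, is_derive t (1 : R) (F s) (Fy s t)) ->
  (forall s t, is_derive t (1 : R) (Fx s) (Fxy s t)) ->
  (forall s t, is_derive s (1 : R) (Fy^~ t) (Fyx s t)) ->
  (forall e : R, 0 < e -> exists2 d : R, 0 < d & forall s t,
    `|s| <= d -> `|t| <= d -> `|Fxy s t - Fxy 0 0| < e) ->
  (forall e : R, 0 < e -> exists2 d : R, 0 < d & forall s t,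
    `|s| <= d -> `|t| <= d -> `|Fyx s t - Fyx 0 0| < e) ->
  Fxy 0 0 = Fyx 0 0.
Proof.
move=> dFx dFy dFxy dFyx cxy cyx; apply/eqP; rewrite -subr_eq0 -normr_le0.
apply/ler_addgt0Pr => e e0; rewrite add0r.
have e20 : 0 < e / 2 by rewrite divr_gt0.
have [d1 d10 H1] := cxy _ e20; have [d2 d20 H2] := cyx _ e20.
pose h := Num.min d1 d2.
have h0 : 0 < h by rewrite lt_min d10.
have [hd1 hd2] : h <= d1 /\ h <= d2 by split; rewrite ge_min lexx ?orbT.
have [s1 s1h E1] := mvt_increment h0 (fun s => is_deriveB (dFx s h) (dFx s 0)).
have [t1 t1h E1'] := mvt_increment h0 (dFxy s1).
have [t2 t2h E2] := mvt_increment h0 (fun t => is_deriveB (dFy h t) (dFy 0 t)).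
have [s2 s2h E2'] := mvt_increment h0 (dFyx ^~ t2).
have E : Fxy s1 t1 = Fyx s2 t2.
  have hh : h * h != 0 by rewrite mulf_neq0 // gt_eqF.
  apply: (mulIf hh); rewrite !mulrA -E1' -E2' -E1 -E2 /=.
  by rewrite !fctE; ring.
have := H1 s1 t1 (le_trans s1h hd1) (le_trans t1h hd1).
have := H2 s2 t2 (le_trans s2h hd2) (le_trans t2h hd2).
rewrite -E !ltr_distl => /andP[? ?] /andP[? ?].
by rewrite ler_norml; apply/andP; split; lra.
Qed.

Lemma is_deriveP (K : numFieldType) (V : normedModType K) (f : V -> K)
    (a v : V) (l : K) :
  (h^-1 * (f (h *: v + a) - f a) @[h --> 0^'] --> l)%classic <->
  is_derive a v f l.
Proof.
split=> [H|[H <-]]; last exact: H.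
split; first by apply/cvg_ex; exists l; exact: H.
exact/cvg_lim.
Qed.

(** Over [R[i]] a positive element is a positive real, so in this form limits over K and over R can
    be compared radius by radius. *)
Lemma is_derive_eps (K : numFieldType) (V : normedModType K) (f : V -> K)
    (a v : V) (l : K) :
  is_derive a v f l <->
  (forall e : K, 0 < e -> exists2 d : K, 0 < d & forall h : K,
     h != 0 -> `|h| < d -> `|l - h^-1 * (f (h *: v + a) - f a)| < e).
Proof.
rewrite -is_deriveP cvgrPdist_lt; split=> H e /H.
- rewrite near_withinE => /nbhs_ballP [d d0 Hd]; exists d => // h h0 hd.
  by apply: Hd => //; rewrite -ball_normE /= sub0r normrN.
- move=> [d d0 Hd]; rewrite near_withinE; apply/nbhs_ballP; exists d => //= h.
  by rewrite -ball_normE /= sub0r normrN => hd h0; exact: Hd.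
Qed.

(* [i] embeds the reals in the scalar field and [phi] is the identity of R or
   the real or imaginary part of a complex number. *)
Record real_part (R : realType) (K : numFieldType) (i : {rmorphism R -> K})
    (phi : K -> R) : Prop := RealPart {
  rp_norm : forall x, `|i x| = i `|x|;
  rp_lt : forall x y, (i x < i y) = (x < y);
  rp_pos : forall d : K, 0 < d -> exists2 r : R, 0 < r & i r = d;
  rp_sub : forall x y, phi (x - y) = phi x - phi y;
  rp_scale : forall r z, phi (i r * z) = r * phi z;
  rp_le : forall z, i `|phi z| <= `|z| }.

(** On increments [i h] with h real, [phi] commutes with difference quotients, and it does not
    increase the modulus; a radius that works for [f] thus works for [phi \o g]. *)
Lemma is_derive_real_part (R : realType) (K : numFieldType)
    (i : {rmorphism R -> K}) (phi : K -> R) (g : R -> K) (l : K) (s : R) 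
    (f : K * K -> K) (a v : K * K) :
  real_part i phi ->
  (forall h : R, g (h + s) = f (i h *: v + a)) ->
  is_derive a v f l ->
  is_derive s (1 : R) (phi \o g) (phi l).
Proof.
move=> rp gf /is_derive_eps fl; apply/is_derive_eps => e e0.
have /fl [_ /(rp_pos rp) [d d0 <-] Hd] : 0 < i e by rewrite -(rmorph0 i) (rp_lt rp).
exists d => // h h0 hd.
have := Hd (i h); rewrite fmorph_eq0 (rp_norm rp) (rp_lt rp) => /(_ h0 hd).
have ga : g s = f a by rewrite -[s]add0r gf rmorph0 scale0r add0r.
rewrite /= scaler1 gf ga -fmorphV -(rp_sub rp) -(rp_scale rp) -(rp_sub rp).
by move=> H; rewrite -(rp_lt rp); apply: le_lt_trans H; exact: rp_le.
Qed.

Lemma schwarz_part (R : realType) (K : numFieldType)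
    (i : {rmorphism R -> K}) (phi : K -> R) (f : K * K -> K) (p : K * K) :
  real_part i phi -> smooth f ->
  phi (pdx (pdy f) p) = phi (pdy (pdx f) p).
Proof.
move=> rp /(_ 2) [_ [fx fy [cfx [_ fxy cfxx [cfxy _]]] [cfy [fyx _ [cfyx _] _]]]].
pose q s t : K * K := (i s + p.1, i t + p.2).
have qx h s t : q (h + s) t = i h *: (dirx K) + q s t.
  apply/eqP; rewrite /q xpair_eqE /= rmorphD scaler0 add0r !eqxx andbT.
  by rewrite -addrA /GRing.scale /= mulr1.
have qy h s t : q s (h + t) = i h *: (diry K) + q s t.
  apply/eqP; rewrite /q xpair_eqE /= rmorphD scaler0 add0r !eqxx /=.
  by rewrite -addrA /GRing.scale /= mulr1.
have cont (g : K * K -> K) : continuous g -> forall e : R, 0 < e ->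
    exists2 d : R, 0 < d & forall s t, `|s| <= d -> `|t| <= d ->
      `|phi (g (q s t)) - phi (g (q 0 0))| < e.
  move=> cg e e0; have /cvgrPdist_lt := cg (q 0 0).
  have ie0 : 0 < i e by rewrite -(rmorph0 i) (rp_lt rp).
  move=> /(_ _ ie0) /nbhs_ballP [_ /(rp_pos rp) [d d0 <-] Hd].
  (* Halving the radius turns the closed bounds of [schwarz_real] into membership in an open
     ball. *)
  exists (d / 2); first by rewrite divr_gt0.
  have small s : `|s| <= d / 2 -> `|i s| < i d.
    by rewrite (rp_norm rp) (rp_lt rp) => ?; lra.
  move=> s t /small sd /small td; rewrite -(rp_sub rp) -(rp_lt rp).
  apply: le_lt_trans (rp_le rp _) _; rewrite distrC; apply: Hd.
  by split; rewrite -ball_normE /= rmorph0 add0r opprD addrCA subrr addr0 normrN.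
have := @schwarz_real R (fun s t => phi (f (q s t)))
  (fun s t => phi (pdx f (q s t))) (fun s t => phi (pdy f (q s t)))
  (fun s t => phi (pdy (pdx f) (q s t))) (fun s t => phi (pdx (pdy f) (q s t))).
have -> : p = q 0 0 by rewrite /q !rmorph0 !add0r; case: (p).
move=> H; symmetry; apply: H.
- move=> s t; apply: (is_derive_real_part (g := fun s => f (q s t)) rp _ (derivableP (fx _))).
  by move=> h; rewrite qx.
- move=> s t; apply: (is_derive_real_part (g := fun t => f (q s t)) rp _ (derivableP (fy _))).
  by move=> h; rewrite qy.
- move=> s t; apply: (is_derive_real_part (g := fun t => pdx f (q s t)) rp _ (derivableP (fxy _))).
  by move=> h; rewrite qy.
- move=> s t; apply: (is_derive_real_part (g := fun s => pdy f (q s t)) rp _ (derivableP (fyx _))).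
  by move=> h; rewrite qx.
- exact: cont.
- exact: cont.
Qed.

Lemma complex_real_part (R : realType) (phi : R[i]%C -> R) :
  phi = @complex.Re R \/ phi = @complex.Im R ->
  real_part (real_complex R) phi.
Proof.
move=> phiE; split.
- by move=> x; rewrite normc_def /= expr0n addr0 sqrtr_sqr.
- by move=> x y; rewrite ltcR.
- by move=> [a b]; rewrite ltcE /= => /andP[/eqP -> a0]; exists a.
- by case: phiE => -> [a b] [c d].
- by case: phiE => -> r [a b] /=; rewrite mul0r ?subr0 ?addr0.
- move=> [a b]; rewrite normc_def lecR -sqrtr_sqr ler_wsqrtr //.
  by case: phiE => -> /=; rewrite ?lerDl ?lerDr sqr_ge0.
Qed.

Lemma schwarz (K : numFieldType) (f : K * K -> K) :
  real_or_complex K -> smooth f -> pdx (pdy f) = pdy (pdx f).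
Proof.
move=> hK sf; apply: funext => p; case: hK f p sf => R f p sf.
- have rp : @real_part R R idfun id by split=> // d d0; exists d.
  exact: (schwarz_part p rp sf).
- have rp1 := complex_real_part (phi := @complex.Re R) (or_introl erefl).
  have rp2 := complex_real_part (phi := @complex.Im R) (or_intror erefl).
  have := schwarz_part p rp2 sf; have := schwarz_part p rp1 sf.
  by case: (pdx _ p) => a b; case: (pdy _ p) => c d /= -> ->.
Qed.

Lemma smooth_pdx (K : numFieldType) (f : K * K -> K) : smooth f -> smooth (pdx f).
Proof. by move=> sf n; have [_ []] := sf n.+1. Qed.

Lemma smooth_pdy (K : numFieldType) (f : K * K -> K) : smooth f -> smooth (pdy f).
Proof. by move=> sf n; have [_ []] := sf n.+1. Qed.

Lemma smooth_pdxy (K : numFieldType) (a b : nat) (f : K * K -> K) :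
  smooth f -> smooth (pdxy a b f).
Proof.
move=> sf; rewrite /pdxy; elim: a => [|a IHa]; last exact: smooth_pdx.
by elim: b => // b IHb; exact: smooth_pdy.
Qed.

Lemma is_derive_pdxy_x (K : numFieldType) (f : K * K -> K) (a b : nat) (p : K * K) :
  smooth f -> is_derive p (dirx K) (pdxy a b f) (pdxy a.+1 b f p).
Proof.
by move=> /(smooth_pdxy a b) /(_ 1) [_ [fx _ _ _]]; exact: derivableP (fx p).
Qed.

(** In [pdxy] the x-derivatives are outermost, so a further y-derivative has to be moved past them
    by Schwarz's theorem. *)
Lemma is_derive_pdxy_y (K : numFieldType) (f : K * K -> K) (a b : nat) (p : K * K) :
  real_or_complex K -> smooth f ->
  is_derive p (diry K) (pdxy a b f) (pdxy a b.+1 f p).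
Proof.
move=> hK sf; have /(_ 1) [_ [_ fy _ _]] := smooth_pdxy a b sf.
suff -> : pdxy a b.+1 f = pdy (pdxy a b f) by exact: derivableP (fy p).
elim: a {fy} => // a IHa.
rewrite [LHS]iterS -/(pdxy a b.+1 f) IHa schwarz //; exact: smooth_pdxy.
Qed.

(** * Total derivatives of jet functions *)

(** The difference quotients of [f \o L] at [a] along [v] are exactly those of [f] at [L a] along
    [L v]. *)
Lemma is_derive_comp_lin (K : numFieldType) (V W : normedModType K)
    (f : W -> K) (L : V -> W) (a v : V) (l : K) :
  (forall h, L (h *: v + a) = h *: L v + L a) ->
  is_derive (L a) (L v) f l -> is_derive a v (f \o L) l.
Proof.
move=> Llin /is_deriveP fl; apply/is_deriveP; move: fl.
by under eq_fun do rewrite -Llin.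
Qed.

Definition plane (K : numFieldType) (k : nat) (z : jet K k) : K * K :=
  (jx z, jy z ord0).

(** Natural indices spare casts between jet orders; beyond order k, [inord] falls back to index
    0. *)
Definition jcoord (K : numFieldType) (k : nat) (z : jet K k) (n : nat) : K :=
  jy z (inord n).

(** The existence of all partial derivatives is part of the relation, since the sum and product
    rules require it. *)
Definition has_total_diff (K : numFieldType) (k : nat) (F : jet K k -> K)
    (z : jet K k.+1) (v : K) : Prop :=
  exists dx, exists dy : 'I_k.+1 -> K,
  [/\ is_derive (jet_proj (leqnSn k) z : K * 'rV[K]_k.+1)
        ((1, 0) : K * 'rV[K]_k.+1) F dx,
      forall i, is_derive (jet_proj (leqnSn k) z : K * 'rV[K]_k.+1)
        ((0, delta_mx 0 i) : K * 'rV[K]_k.+1) F (dy i) &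
      v = dx + \sum_(i < k.+1) jcoord z i.+1 * dy i].

Lemma jcoord_lift (K : numFieldType) (k : nat) (z : jet K k.+1) (i : 'I_k.+1) :
  jcoord z i.+1 = jy z (lift ord0 i).
Proof. by congr (jy z); apply: val_inj; rewrite /= inordK // ltnS ltn_ord. Qed.

Lemma jcoord_proj (K : numFieldType) (k : nat) (z : jet K k.+1) (n : nat) :
  (n <= k)%N -> jcoord (jet_proj (leqnSn k) z) n = jcoord z n.
Proof.
move=> nk; rewrite /jcoord /jy /jet_proj mxE /=; congr (z.2 0 _).
by apply: val_inj; rewrite /= !inordK ?ltnS ?leqW.
Qed.

Lemma plane_proj (K : numFieldType) (m k : nat) (mk : (m <= k)%N) (z : jet K k) :
  plane (jet_proj mk z) = plane z.
Proof.
rewrite /plane /jx /jy /jet_proj mxE /=; congr (_, z.2 0 _).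
exact: val_inj.
Qed.

Section HasTotalDiff.
Variables (K : numFieldType) (k : nat).
Implicit Types (F G : jet K k -> K) (z : jet K k.+1).

Lemma total_diffE F z v : has_total_diff F z v -> total_diff F z = v.
Proof.
move=> [dx [dy [Fx Fy ->]]]; rewrite /total_diff /jdx /jdy.
rewrite (@derive_val _ _ _ _ _ _ _ Fx); congr (_ + _); apply: eq_bigr => i _.
by rewrite jcoord_lift (@derive_val _ _ _ _ _ _ _ (Fy i)).
Qed.

Lemma has_total_diff_cst c z : has_total_diff (fun=> c) z 0.
Proof.
exists 0, (fun=> 0); split=> [|i|]; try exact: is_derive_cst.
by rewrite big1 ?addr0 // => i _; rewrite mulr0.
Qed.

Lemma has_total_diffD F G z u v : has_total_diff F z u -> has_total_diff G z v ->
  has_total_diff (fun x => F x + G x) z (u + v).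
Proof.
move=> [dx [dy [Fx Fy ->]]] [dx' [dy' [Gx Gy ->]]].
exists (dx + dx'), (fun i => dy i + dy' i); split=> [|i|].
- exact: is_deriveD.
- exact: is_deriveD.
- by rewrite addrACA -big_split /=; congr (_ + _); apply: eq_bigr => i _; rewrite mulrDr.
Qed.

Lemma has_total_diffM F G z u v : has_total_diff F z u -> has_total_diff G z v ->
  has_total_diff (fun x => F x * G x) z
    (u * G (jet_proj (leqnSn k) z) + F (jet_proj (leqnSn k) z) * v).
Proof.
move=> [dx [dy [Fx Fy ->]]] [dx' [dy' [Gx Gy ->]]].
set z' := jet_proj _ z.
exists (F z' * dx' + G z' * dx), (fun i => F z' * dy' i + G z' * dy i); split=> [|i|].
- exact: is_deriveM.
- exact: is_deriveM.
- rewrite mulrDl mulrDr mulr_suml mulr_sumr addrACA -big_split /=.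
  congr (_ + _); first by ring.
  by apply: eq_bigr => i _; ring.
Qed.

Lemma has_total_diffZ c F z v : has_total_diff F z v ->
  has_total_diff (fun x => c * F x) z (c * v).
Proof.
by move=> /(has_total_diffM (has_total_diff_cst c z)); rewrite mul0r add0r.
Qed.

Lemma has_total_diffB F G z u v : has_total_diff F z u -> has_total_diff G z v ->
  has_total_diff (fun x => F x - G x) z (u - v).
Proof.
move=> Fu Gv; rewrite -mulN1r.
under eq_fun do rewrite -mulN1r.
apply: has_total_diffD Fu _; exact: has_total_diffZ.
Qed.

Lemma has_total_diff_sum (I : Type) (r : seq I) (F : I -> jet K k -> K)
    (v : I -> K) z :
  (forall i, has_total_diff (F i) z (v i)) ->
  has_total_diff (fun x => \sum_(i <- r) F i x) z (\sum_(i <- r) v i).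
Proof.
move=> FP; elim: r => [|i r IHr].
  by under eq_fun do rewrite big_nil; rewrite big_nil; exact: has_total_diff_cst.
by under eq_fun do rewrite big_cons; rewrite big_cons; exact: has_total_diffD.
Qed.

Lemma has_total_diff_jcoord n z : (n <= k)%N ->
  has_total_diff (fun x => jcoord x n) z (jcoord z n.+1).
Proof.
move=> nk.
have jlin (v : K * 'rV[K]_k.+1) : is_derive (jet_proj (leqnSn k) z) v
    ((fun x => jcoord x n) : K * 'rV[K]_k.+1 -> K) (v.2 0 (inord n)).
  apply: (@is_derive_comp_lin K (K * 'rV[K]_k.+1)%type K id
    (fun x => jcoord x n) (jet_proj (leqnSn k) z) v).
  by move=> h; rewrite /jcoord /jy !mxE.
exists 0, (fun i => (inord n == i)%:R); split=> [|i|].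
- by have := jlin ((1, 0)); rewrite /= mxE.
- by have := jlin ((0, delta_mx 0 i)); rewrite /= mxE eqxx eq_sym.
- rewrite add0r (bigD1 (inord n)) //= eqxx mulr1 big1 ?addr0 ?inordK //.
  by move=> i /negbTE; rewrite eq_sym => ->; rewrite mulr0.
Qed.

Lemma has_total_diff_plane (f fx fy : K * K -> K) z :
  (forall p, is_derive p (dirx K) f (fx p)) ->
  (forall p, is_derive p (diry K) f (fy p)) ->
  has_total_diff (fun x => f (plane x)) z
    (fx (plane z) + jcoord z 1 * fy (plane z)).
Proof.
move=> dfx dfy; rewrite -(plane_proj (leqnSn k)); set z' := jet_proj _ z.
have plin (v : K * 'rV[K]_k.+1) l : is_derive (plane z') (v.1, v.2 0 ord0) f l ->
    is_derive (z' : K * 'rV[K]_k.+1) v (fun x => f (plane (x : jet K k))) l.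
  apply: (@is_derive_comp_lin K (K * 'rV[K]_k.+1)%type (K * K)%type f
    (fun x => plane (x : jet K k)) z' v).
  by move=> h; rewrite /plane /jx /jy !mxE.
exists (fx (plane z')), (fun i => if i == ord0 then fy (plane z') else 0); split=> [|i|].
- by apply: plin; rewrite mxE; exact: dfx.
(* For i > 0 the direction of y_i projects to the zero vector of the plane. *)
- apply: plin; rewrite mxE eqxx /= eq_sym; case: eqP => _; first exact: dfy.
  exact: is_derive0.
- rewrite big_ord_recl /= big1 ?addr0 // => i _.
  by rewrite mulr0.
Qed.

End HasTotalDiff.

(** * Coefficientwise total derivatives of polynomials in the formal variable t *)

Definition has_poly_total_diff (K : numFieldType) (k : nat)
    (P : jet K k -> {poly K}) (z : jet K k.+1) (Q : {poly K}) : Prop :=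
  forall n, has_total_diff (fun x => (P x)`_n) z Q`_n.

Section HasPolyTotalDiff.
Variables (K : numFieldType) (k : nat).
Implicit Types (P Q : jet K k -> {poly K}) (z : jet K k.+1).

Lemma has_poly_total_diff_cst c z : has_poly_total_diff (fun=> c) z 0.
Proof. by move=> n; rewrite coef0; exact: has_total_diff_cst. Qed.

Lemma has_poly_total_diffM P Q z p q :
  has_poly_total_diff P z p -> has_poly_total_diff Q z q ->
  has_poly_total_diff (fun x => P x * Q x) z
    (p * Q (jet_proj (leqnSn k) z) + P (jet_proj (leqnSn k) z) * q).
Proof.
move=> Pp Qq n; under eq_fun do rewrite coefM.
rewrite coefD !coefM -big_split /=; apply: has_total_diff_sum => i.
exact: has_total_diffM.
Qed.

Lemma has_poly_total_diffX P z p s :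
  has_poly_total_diff P z p ->
  has_poly_total_diff (fun x => P x ^+ s) z
    (p * P (jet_proj (leqnSn k) z) ^+ s.-1 *+ s).
Proof.
move=> Pp; elim: s => [|s IHs].
  by under eq_fun do rewrite expr0; exact: has_poly_total_diff_cst.
under eq_fun do rewrite exprS; have := has_poly_total_diffM Pp IHs.
set z' := jet_proj _ z; rewrite -mulrnAr mulrCA -mulrnAr.
have -> : P z' * (P z' ^+ s.-1 *+ s) = P z' ^+ s *+ s.
  by case: (s) => [|t]; rewrite ?mulr0n ?mulr0 // mulrnAr -exprS.
by rewrite -mulrDr -mulrS mulrnAr.
Qed.

Lemma has_poly_total_diff_deriv P z p :
  has_poly_total_diff P z p ->
  has_poly_total_diff (fun x => (P x)^`()) z p^`().
Proof.
move=> Pp n; rewrite coef_deriv -mulr_natl.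
under eq_fun do rewrite coef_deriv -mulr_natl.
exact: has_total_diffZ.
Qed.

End HasPolyTotalDiff.

(* The formal Taylor expansion of y(x + t) - y(x), truncated at order k. *)
Definition taylor (K : numFieldType) (k : nat) (z : jet K k) : {poly K} :=
  \poly_(i < k.+1) (if i == 0 then 0 else jcoord z i / i`!%:R).

Lemma coef0_taylor (K : numFieldType) (k : nat) (z : jet K k) : (taylor z)`_0 = 0.
Proof. by rewrite coef_poly. Qed.

Lemma coef1_taylor (K : numFieldType) (k : nat) (z : jet K k.+1) :
  (taylor z)`_1 = jcoord z 1.
Proof. by rewrite coef_poly /= divr1. Qed.

Lemma taylor_proj (K : numFieldType) (k : nat) (z : jet K k.+1) :
  taylor z = taylor (jet_proj (leqnSn k) z)
             + (jcoord z k.+1 / k.+1`!%:R) *: 'X^(k.+1).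
Proof.
apply/polyP => n; rewrite coefD coefZ coefXn !coef_poly.
have [->|nk] := eqVneq n k.+1; first by rewrite ltnSn ltnn mulr1 add0r.
rewrite mulr0 addr0 [(n < k.+2)%N]ltnS leq_eqVlt (negbTE nk) /=.
by case: ifP => // nk'; rewrite jcoord_proj.
Qed.

(** Sending y_i to y_(i+1) shifts the Taylor coefficients, which is d/dt. The constant coefficient
    of g is 0 instead of y, so the y_1 that d/dt produces there is subtracted. The result uses the
    jet of order k + 1, which supplies y_(k+1). *)
Lemma has_poly_total_diff_taylor (K : numFieldType) (k : nat) (z : jet K k.+1) :
  has_poly_total_diff (@taylor K k) z ((taylor z)^`() - (jcoord z 1)%:P).
Proof.
move=> n; under eq_fun do rewrite coef_poly.
rewrite coefB coef_deriv coefC coef_poly !ltnS.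
case: leqP => nk; last first.
  rewrite ifN ?subr0 ?mul0rn; first exact: has_total_diff_cst.
  by case: (n) nk.
case: eqP => [->|/eqP n0] /=; first by rewrite divr1 subrr; exact: has_total_diff_cst.
rewrite subr0 factS natrM invfM mulrA -mulrnAl -[_ *+ n.+1]mulr_natr mulfVK ?pnatr_eq0 //.
under eq_fun do rewrite mulrC; rewrite [X in has_total_diff _ _ X]mulrC.
apply: has_total_diffZ; exact: has_total_diff_jcoord.
Qed.

(** * Formal Faa di Bruno expansion *)

Definition coef_agree (R : comNzRingType) (n : nat) (p q : {poly R}) : Prop :=
  forall i, (i < n)%N -> p`_i = q`_i.

Lemma coef_agreeM (R : comNzRingType) (n : nat) (p p' q q' : {poly R}) :
  coef_agree n p p' -> coef_agree n q q' -> coef_agree n (p * q) (p' * q').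
Proof.
move=> pp' qq' i ilt; rewrite !coefM; apply: eq_bigr => j _.
rewrite pp' ?qq' // (leq_ltn_trans _ ilt) ?leq_subr //.
by rewrite -ltnS.
Qed.

Lemma coef_agreeX (R : comNzRingType) (n s : nat) (p q : {poly R}) :
  coef_agree n p q -> coef_agree n (p ^+ s) (q ^+ s).
Proof. by move=> pq; elim: s => // s IHs; rewrite !exprS; exact: coef_agreeM. Qed.

(** As t divides g, t^s divides h g^s. *)
Lemma coefMX_lt (K : numFieldType) (h g : {poly K}) (n s : nat) :
  g`_0 = 0 -> (n < s)%N -> (h * g ^+ s)`_n = 0.
Proof.
move=> g0 ns.
have gs i t : (i < t)%N -> (g ^+ t)`_i = 0.
  elim: t i => // t IHt i it; rewrite exprS coefM; apply: big1 => -[[|a] /= ai] _.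
    by rewrite g0 mul0r.
  by rewrite IHt ?mulr0 // ltn_subLR // (leq_trans it) // ltnS leq_addl.
by rewrite coefM big1 // => a _; rewrite gs ?mulr0 // (leq_ltn_trans _ ns) ?leq_subr.
Qed.

(* With g = sum_(i >= 1) y_i t^i / i!, this is the coefficient of t^j / j! in
   h (t) f (x + t, y + g (t)), where phi a b stands for f_{x^a y^b}; the powers
   of g are cut at N. *)
Definition faa (K : numFieldType) (N j : nat) (phi : nat -> nat -> K)
    (h g : {poly K}) : K :=
  \sum_(w < j.+1) \sum_(s < N)
    (j ^_ w)%:R / s`!%:R * (phi (j - w)%N s * (h * g ^+ s)`_w).

(* The total derivative of [faa N j phi h g] when h1 is the total derivative of
   h and [g^`() - y1%:P] that of g. *)
Definition dfaa (K : numFieldType) (N j : nat) (phi : nat -> nat -> K) (y1 : K)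
    (h h1 g g1 : {poly K}) : K :=
  \sum_(w < j.+1) \sum_(s < N) (j ^_ w)%:R / s`!%:R *
    ((phi (j - w).+1 s + y1 * phi (j - w)%N s.+1) * (h * g ^+ s)`_w
     + phi (j - w)%N s * (h1 * g ^+ s + h * (g1 * g ^+ s.-1 *+ s))`_w).

(** Only coefficients up to t^j are read, so the Taylor polynomials of orders j and j + 1 are
    interchangeable here. *)
Lemma dfaa_agree (K : numFieldType) (N j : nat) (phi : nat -> nat -> K) (y1 : K)
    (h h1 g g1 g' : {poly K}) : coef_agree j.+1 g g' ->
  dfaa N j phi y1 h h1 g g1 = dfaa N j phi y1 h h1 g' g1.
Proof.
move=> gg'; apply: eq_bigr => w _; apply: eq_bigr => s _.
have gX t p : (p * g ^+ t)`_w = (p * g' ^+ t)`_w.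
  by apply: (@coef_agreeM _ j.+1) => //; apply: coef_agreeX.
by rewrite gX -!mulrnAl ![h * (_ * _)]mulrA !coefD !gX.
Qed.

Lemma dfaaB (K : numFieldType) (N j : nat) (phi : nat -> nat -> K) (y1 : K)
    (h h' h1 h1' g g1 : {poly K}) :
  dfaa N j phi y1 (h - h') (h1 - h1') g g1 =
  dfaa N j phi y1 h h1 g g1 - dfaa N j phi y1 h' h1' g g1.
Proof.
rewrite -sumrB; apply: eq_bigr => w _; rewrite -sumrB; apply: eq_bigr => s _.
by rewrite !mulrBl !coefD !coefN; ring.
Qed.

(** Only w = j, s = 0 survives: the monomial removes smaller w, and for s > 0 the vanishing constant
    terms of [g] and [g1] remove the rest. This yields the correction - D(X) y_(j+1) of the
    recursion. *)
Lemma dfaa_monomial (K : numFieldType) (N j : nat) (phi : nat -> nat -> K)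
    (y1 c : K) (g g1 : {poly K}) : g`_0 = 0 -> g1`_0 = 0 ->
  dfaa N.+1 j phi y1 (c *: 'X^j) 0 g g1 = c * j`!%:R * (phi 1 0 + y1 * phi 0 1).
Proof.
move=> g0 g10.
have cX p w : (c *: 'X^j * p)`_w = if (w < j)%N then 0 else c * p`_(w - j).
  by rewrite -scalerAl coefZ coefXnM; case: ifP; rewrite ?mulr0.
rewrite /dfaa big_ord_recr /= big1 ?add0r => [|w _]; last first.
  by apply: big1 => s _; rewrite mul0r add0r !cX ltn_ord !mulr0 addr0 mulr0.
rewrite big_ord_recl big1 ?addr0 => [|s _].
  rewrite mul0r add0r !cX ltnn subnn mulr0n coef0 mulr0 expr0 coefC eqxx.
  by rewrite ffactnn fact0 divr1; ring.
rewrite mul0r add0r !cX ltnn subnn coefMn !coef0M g10 exprS coef0M g0.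
by rewrite !(mul0r, mul0rn, mulr0) addr0 mulr0.
Qed.

(** The y1 terms telescope in s. What remains is the x-derivative of the partial derivatives plus
    the t-derivative of h g^s, and these recombine at order j + 1 by the Pascal rule for falling
    factorials. *)
Lemma dfaa_deriv (K : numFieldType) (N j : nat) (phi : nat -> nat -> K)
    (y1 : K) (h g : {poly K}) : g`_0 = 0 -> (j < N)%N ->
  dfaa N.+1 j phi y1 h h^`() g (g^`() - y1%:P) = faa N.+1 j.+1 phi h g.
Proof.
move=> g0 jN.
pose c w s : K := (j ^_ w)%:R / s`!%:R.
pose e w s : K := (h * g ^+ s)`_w.
have dE w s : (h^`() * g ^+ s + h * ((g^`() - y1%:P) * g ^+ s.-1 *+ s))`_w
   = e w.+1 s *+ w.+1 - y1 * (e w s.-1 *+ s).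
  rewrite /e -coef_deriv derivM deriv_exp mulrBl mulrnBl mulrBr addrA coefB.
  congr (_ - _).
  by rewrite mulrnAr mulrCA coefMn coefCM mulrnAr.
have c1 w s : c w s.+1 * s.+1%:R = c w s.
  by rewrite /c factS natrM invfM [_^-1 * _]mulrC mulrA mulfVK ?pnatr_eq0.
have -> : dfaa N.+1 j phi y1 h h^`() g (g^`() - y1%:P) =
   \sum_(w < j.+1) \sum_(s < N.+1) c w s * (phi (j.+1 - w)%N s * e w s) +
   \sum_(w < j.+1) \sum_(s < N.+1) c w s * (phi (j - w)%N s * (e w.+1 s *+ w.+1)).
  rewrite -big_split; apply: eq_bigr => w _ /=.
  (* The term s on the left matches the term s + 1 on the right; the unmatched term s = N vanishes
     because w <= j < N. *)
  have telescope : \sum_(s < N.+1) c w s * (phi (j - w)%N s.+1 * e w s)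
      = \sum_(s < N.+1) c w s * (phi (j - w)%N s * (e w s.-1 *+ s)).
    rewrite [LHS]big_ord_recr [RHS]big_ord_recl /= !mulr0 add0r.
    rewrite [e w N]coefMX_lt ?mulr0 ?addr0 //; last first.
      by rewrite (leq_trans _ jN) // ltn_ord.
    apply: eq_bigr => s _; rewrite -c1 /bump /= add1n -mulr_natr; ring.
  transitivity (\sum_(s < N.+1) c w s * (phi (j.+1 - w)%N s * e w s) +
      \sum_(s < N.+1) c w s * (phi (j - w)%N s * (e w.+1 s *+ w.+1)) +
      y1 * (\sum_(s < N.+1) c w s * (phi (j - w)%N s.+1 * e w s)
         - \sum_(s < N.+1) c w s * (phi (j - w)%N s * (e w s.-1 *+ s)))).
    rewrite -sumrB mulr_sumr -!big_split /=; apply: eq_bigr => s _.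
    have wj : (w <= j)%N by rewrite -ltnS.
    by rewrite dE (subSn wj) -/(c w s) -/(e w s) -mulr_natr; ring.
  by rewrite telescope subrr mulr0 addr0.
rewrite /faa.
(* Both sums are brought to the range w <= j + 1: the term added here has the factor [j ^_ j.+1],
   which is 0, and the one added to the shifted sum below has the factor w = 0. *)
have -> : \sum_(w < j.+1) \sum_(s < N.+1) c w s * (phi (j.+1 - w)%N s * e w s)
   = \sum_(w < j.+2) \sum_(s < N.+1) c w s * (phi (j.+1 - w)%N s * e w s).
  rewrite [RHS]big_ord_recr /= [X in _ + X]big1 ?addr0 // => s _.
  by rewrite /c ffact_small // mul0r mul0r.
have -> : \sum_(w < j.+1) \sum_(s < N.+1)
    c w s * (phi (j - w)%N s * (e w.+1 s *+ w.+1)) = \sum_(w < j.+2)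
    \sum_(s < N.+1) c w.-1 s * (phi (j.+1 - w)%N s * (e w s *+ w)).
  rewrite [RHS]big_ord_recl [X in X + _]big1 ?add0r // => s _.
  by rewrite !mulr0.
rewrite -big_split; apply: eq_bigr => w _ /=; rewrite -big_split.
apply: eq_bigr => s _ /=; rewrite /c /e -mulr_natr.
case: w => [[|v] /= vj]; first by rewrite !ffactn0; ring.
have -> : (j.+1 ^_ v.+1 = j ^_ v.+1 + v.+1 * j ^_ v)%N.
  by rewrite ffactSS ffactnSr [(v.+1 * _)%N]mulnC -mulnDr addnS subnK // mulnC.
by rewrite natrD natrM; ring.
Qed.

(** * Prolongation coefficients in Faa di Bruno form *)

Definition jpd (K : numFieldType) (k : nat) (f : K * K -> K) (z : jet K k)
    (a b : nat) : K := pdxy a b f (plane z).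

Lemma has_total_diff_faa (K : numFieldType) (k N j : nat) (f : K * K -> K)
    (h : jet K k -> {poly K}) (h1 : {poly K}) (z : jet K k.+1) :
  real_or_complex K -> smooth f -> has_poly_total_diff h z h1 ->
  has_total_diff (fun x => faa N j (jpd f x) (h x) (taylor x)) z
    (dfaa N j (jpd f z) (jcoord z 1) (h (jet_proj (leqnSn k) z)) h1
       (taylor (jet_proj (leqnSn k) z)) ((taylor z)^`() - (jcoord z 1)%:P)).
Proof.
move=> hK sf hh1; apply: has_total_diff_sum => w; apply: has_total_diff_sum => s.
apply: has_total_diffZ.
have := has_total_diffM
  (has_total_diff_plane z (fun p => is_derive_pdxy_x (j - w) s p sf)
                          (fun p => is_derive_pdxy_y (j - w) s p hK sf))
  (has_poly_total_diffM hh1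
     (has_poly_total_diffX s (has_poly_total_diff_taylor z)) w).
by rewrite plane_proj.
Qed.

Lemma total_diff_plane (K : numFieldType) (f : K * K -> K) (z : jet K 1) :
  smooth f ->
  total_diff (jet_of_plane f) z = pdx f (plane z) + jcoord z 1 * pdy f (plane z).
Proof.
move=> /(_ 1) [_ [fx fy _ _]]; apply: total_diffE.
by apply: has_total_diff_plane => p; apply: derivableP.
Qed.

Lemma prolong_faa (K : numFieldType) (X Y : K * K -> K) (N j : nat) (z : jet K j) :
  real_or_complex K -> smooth X -> smooth Y -> (j <= N)%N ->
  prolong X Y j z = faa N.+1 j (jpd Y z) 1 (taylor z)
                  - faa N.+1 j (jpd X z) (taylor z)^`() (taylor z).
Proof.
move=> hK sX sY; elim: j z => [|j IHj] z jN.
  have -> : taylor z = 0.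
    by apply/polyP => n; rewrite coef_poly coef0; case: n.
  rewrite /faa !big_ord_recl !big_ord0 !big1 => [|s _|s _].
  - rewrite !addr0 subn0 ffactn0 fact0 mulr1 deriv0 mul0r coef0 coefC eqxx.
    by rewrite mulr0 mulr0 subr0 divr1 mul1r mulr1.
  - by rewrite exprS mul0r mulr0 coef0 !mulr0.
  - by rewrite exprS mul0r mulr0 coef0 !mulr0.
have {}IHj : prolong X Y j = fun x =>
    faa N.+1 j (jpd Y x) 1 (taylor x)
    - faa N.+1 j (jpd X x) (taylor x)^`() (taylor x).
  by apply: funext => x; apply: IHj; exact: ltnW.
set z' := jet_proj (leqnSn j) z.
have dtaylor := has_poly_total_diff_taylor z.
have /total_diffE := has_total_diffB
  (has_total_diff_faa N.+1 j hK sY (has_poly_total_diff_cst (1 : {poly K}) z))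
  (has_total_diff_faa N.+1 j hK sX (has_poly_total_diff_deriv dtaylor)).
rewrite -/z' [prolong X Y j.+1 z]/= IHj => ->.
set y := jcoord z j.+1.
have agree : coef_agree j.+1 (taylor z') (taylor z).
  move=> n nj; rewrite (taylor_proj z) coefD coefZ coefXn (ltn_eqF nj).
  by rewrite mulr0 addr0.
(* Differentiating the shorter Taylor polynomial loses exactly the top term y_(j+1) t^j / j! of
   g'. *)
have taylor' : (taylor z')^`() = (taylor z)^`() - (y / j`!%:R) *: 'X^j.
  have yE : y / j.+1`!%:R *+ j.+1 = y / j`!%:R.
    rewrite -mulr_natr factS natrM invfM [_^-1 * _]mulrC mulrA.
    by rewrite mulfVK ?pnatr_eq0.
  by rewrite (taylor_proj z) derivD derivZ derivXn /= -scalerMnr scalerMnl yE addrK.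
have one' : (1 : {poly K})^`() = 0 by rewrite -polyC1 derivC.
rewrite !(dfaa_agree _ _ _ _ _ _ agree) -[X in dfaa _ _ _ _ 1 X]one'.
have g0 := coef0_taylor z.
(* The total derivative of the shorter g' is g'' minus the derivative of the constant y_1; that zero
   is paired with the lost monomial, so [dfaaB] separates the next expansion from the correction. *)
rewrite (dfaa_deriv _ _ _ g0 jN) taylor' derivB derivC dfaaB (dfaa_deriv _ _ _ g0 jN).
rewrite dfaa_monomial ?coefB ?coef_deriv ?coef1_taylor ?coefC ?subrr //.
rewrite divfK ?pnatr_eq0 -?lt0n ?fact_gt0 // total_diff_plane //.
rewrite plane_proj /jpd.
have -> : jcoord (jet_proj (ltn0Sn j) z) 1 = jcoord z 1.
  rewrite /jcoord /jy mxE; congr (z.2 0 _).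
  by apply: val_inj; rewrite /= !inordK.
have -> : jy z ord_max = y.
  by congr (jy z); apply: val_inj; rewrite /= inordK.
rewrite /pdxy /=; ring.
Qed.

(** * Multinomial expansion and reindexing *)

(** The series exp(x T) in a new variable T, cut below T^p. *)
Definition texp (K : numFieldType) (p : nat) (x : {poly K}) : {poly {poly K}} :=
  \poly_(j < p) ((j`!%:R^-1)%:P * x ^+ j).

Lemma texpD (K : numFieldType) (p : nat) (x y : {poly K}) :
  coef_agree p (texp p x * texp p y) (texp p (x + y)).
Proof.
move=> s sp; rewrite coefM coef_poly sp addrC exprDn mulr_sumr.
apply: eq_bigr => -[i /=]; rewrite ltnS => lis _.
rewrite !coef_poly (leq_ltn_trans lis sp) (leq_ltn_trans (leq_subr i s) sp).
have f0 n : n`!%:R != 0 :> K by rewrite pnatr_eq0 -lt0n fact_gt0.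
have binE : i`!%:R^-1 * (s - i)`!%:R^-1 = s`!%:R^-1 * 'C(s, i)%:R :> K.
  by rewrite -(bin_fact lis) !natrM; field; rewrite !f0 pnatr_eq0 -lt0n bin_gt0 lis.
rewrite mulrACA -polyCM binE polyCM -mulrA [x ^+ i * _]mulrC.
by rewrite rmorph_nat mulr_natl.
Qed.

Lemma texp_sum (K : numFieldType) (p : nat) (I : finType) (x : I -> {poly K}) :
  coef_agree p (\prod_i texp p (x i)) (texp p (\sum_i x i)).
Proof.
elim/big_rec2: _ => [|i q r _ IH].
  move=> s sp; rewrite coef_poly sp coefC expr0n.
  by case: eqP => [->|_]; rewrite ?mulr0 // fact0 invr1 mulr1.
move=> s sp; rewrite -(@texpD _ p) //.
by apply: (@coef_agreeM _ p).
Qed.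

(** Compares the coefficients of T^s in exp(T sum x_i) and in the product of the exp(x_i T). *)
Lemma multinomial (K : numFieldType) (p s : nat) (I : finType)
    (x : I -> {poly K}) : (s < p)%N ->
  (s`!%:R^-1)%:P * (\sum_i x i) ^+ s =
  \sum_(M : {ffun I -> 'I_p} | (\sum_i M i)%N == s)
     \prod_i (((M i)`!%:R^-1)%:P * x i ^+ M i).
Proof.
move=> sp; have := texp_sum x sp; rewrite [X in _ = X]coef_poly sp => <-.
under eq_bigr do rewrite /texp poly_def.
rewrite bigA_distr_bigA coef_sum [RHS]big_mkcond; apply: eq_bigr => M _ /=.
rewrite scaler_prod -expr_sum coefZ coefXn eq_sym.
by case: eqP => _; rewrite ?mulr1 ?mulr0.
Qed.

Lemma sum_fiber (V : nmodType) (I : finType) (P : pred I) (a : I -> nat) (n : nat)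
    (F : nat -> I -> V) :
  \sum_(w < n) \sum_(i | P i && (a i == w)) F w i =
  \sum_(i | P i && (a i < n)%N) F (a i) i.
Proof.
under eq_bigr do rewrite big_mkcondr.
rewrite exchange_big [RHS]big_mkcondr; apply: eq_bigr => i _ /=.
case: ltnP => [an|na].
  rewrite (bigD1 (Ordinal an)) //= eqxx big1 ?addr0 // => w.
  by rewrite -val_eqE /= eq_sym => /negbTE ->.
by apply: big1 => w _; rewrite gtn_eqF // (leq_trans _ na).
Qed.

(** * Correspondence between pairs (l, mu) and multiplicity functions *)

Section Multiplicities.
Variable k : nat.
Implicit Types (M : {ffun 'I_k.+1 -> 'I_k.+2}).

Definition supp M : {set 'I_k.+1} := [set j | (0 < M j)%N].
Definition weight M : nat := (\sum_j M j * j)%N.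
Definition mdegree M : nat := (\sum_j M j)%N.

Variable d : nat.
Implicit Types (l : {ffun 'I_d -> 'I_k.+1}) (m : {ffun 'I_d -> 'I_k.+2}).

(** Extension of mu by zero outside the image of [l]; [gather] inverts it by listing the support in
    increasing order. *)
Definition spread (lm : {ffun 'I_d -> 'I_k.+1} * {ffun 'I_d -> 'I_k.+2}) :
    {ffun 'I_k.+1 -> 'I_k.+2} :=
  [ffun j => if [pick i | lm.1 i == j] is Some i then lm.2 i else ord0].

Definition gather M : {ffun 'I_d -> 'I_k.+1} * {ffun 'I_d -> 'I_k.+2} :=
  ([ffun i : 'I_d => nth ord0 (enum (supp M)) i],
   [ffun i : 'I_d => M (nth ord0 (enum (supp M)) i)]).

Lemma increasing_pos_inj l : increasing_pos l -> injective l.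
Proof.
move=> /andP[_ /forallP linc] i j lij; apply/eqP; case: (ltngtP i j) => [ij|ji|/val_inj->//].
  by have /forallP/(_ j) := linc i; rewrite ij lij ltnn.
by have /forallP/(_ i) := linc j; rewrite ji lij ltnn.
Qed.

Lemma spreadE l m i : injective l -> spread (l, m) (l i) = m i.
Proof.
move=> linj; rewrite ffunE; case: pickP => [j /= /eqP /linj -> //|/(_ i)].
by rewrite /= eqxx.
Qed.

Lemma supp_spread l m : injective l -> all_pos m -> supp (spread (l, m)) = l @: 'I_d.
Proof.
move=> linj /forallP mpos; apply/setP => j; rewrite inE.
apply/idP/imsetP => [|[i _ ->]]; last by rewrite spreadE.
by rewrite ffunE /=; case: pickP => // i /eqP <- _; exists i.
Qed.

Lemma sorted_enum_ord n (A : {set 'I_n}) :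
  sorted (fun i j : 'I_n => (i < j)%N) (enum A).
Proof.
rewrite {1}/enum_mem sorted_filter //; first by move=> ? ? ?; exact: ltn_trans.
by have := iota_ltn_sorted 0 n; rewrite -val_enum_ord sorted_map enumT.
Qed.

(** Two strictly increasing lists with the same elements coincide. *)
Lemma enum_imset_increasing l : increasing_pos l ->
  enum (l @: 'I_d) = [seq l i | i <- enum 'I_d].
Proof.
move=> linc; apply: (@irr_sorted_eq _ (fun i j : 'I_k.+1 => (i < j)%N)).
- by move=> ? ? ?; exact: ltn_trans.
- by move=> ?; rewrite ltnn.
- exact: sorted_enum_ord.
- apply: (@homo_sorted _ _ _ (fun i j : 'I_d => (i < j)%N)); last first.
    by have := iota_ltn_sorted 0 d; rewrite -val_enum_ord sorted_map.
  move=> i j ij; have /andP[_ /forallP/(_ i)/forallP/(_ j)] := linc.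
  by rewrite ij.
- move=> j; rewrite mem_enum; apply/imsetP/mapP => -[i _ ->]; exists i => //.
  exact: mem_enum.
Qed.

Lemma spreadK l m : increasing_pos l -> all_pos m -> gather (spread (l, m)) = (l, m).
Proof.
move=> linc mpos; have linj := increasing_pos_inj linc.
have E (i : 'I_d) : nth ord0 (enum (supp (spread (l, m)))) i = l i.
  rewrite supp_spread // enum_imset_increasing // (nth_map i) ?size_enum_ord //.
  by rewrite nth_ord_enum.
by congr (_, _); apply/ffunP => i; rewrite ffunE E // spreadE.
Qed.

(** The condition at index 0 keeps 0 out of the support, which makes every l_i positive. *)
Lemma gatherP M : M ord0 = ord0 -> #|supp M| = d ->
  [/\ increasing_pos (gather M).1, all_pos (gather M).2 & spread (gather M) = M].
Proof.
move=> M0 sd; set l := (gather M).1.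
have lt_size (i : 'I_d) : (i < size (enum (supp M)))%N by rewrite -cardE sd.
have lsupp i : l i \in supp M by rewrite ffunE -mem_enum mem_nth.
have linc : increasing_pos l.
  apply/andP; split; apply/forallP => i.
    rewrite lt0n; apply: contraTneq (lsupp i) => l0.
    by rewrite inE (_ : l i = ord0) ?M0 //; exact: val_inj.
  apply/forallP => j; apply/implyP => ij; rewrite !ffunE.
  apply: (sorted_ltn_nth (leT := fun i j : 'I_k.+1 => (i < j)%N));
    rewrite ?inE ?lt_size //.
    by move=> ? ? ?; exact: ltn_trans.
  exact: sorted_enum_ord.
have linj := increasing_pos_inj linc.
have mE i : (gather M).2 i = M (l i) by rewrite !ffunE.
split=> //; first by apply/forallP => i; rewrite mE; have := lsupp i; rewrite inE.
apply/ffunP => j; case: (boolP (j \in supp M)) => jM.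
  have ji : (index j (enum (supp M)) < d)%N by rewrite -sd cardE index_mem mem_enum.
  have -> : j = l (Ordinal ji) by rewrite ffunE nth_index // mem_enum.
  by rewrite [gather M]surjective_pairing spreadE // mE.
rewrite ffunE; case: pickP => [i /= /eqP lij|_].
  by move: jM; rewrite -lij lsupp.
by apply: val_inj => /=; move: jM; rewrite inE lt0n negbK => /eqP.
Qed.

(** Indices outside the image of [l] have multiplicity 0 and contribute the neutral element. Stated
    for a general operation, it serves for weights, degrees and monomials. *)
Lemma big_spread (R : Type) (idx : R) (op : Monoid.com_law idx) l m
    (F : 'I_k.+1 -> nat -> R) :
  injective l -> all_pos m -> (forall j, F j 0 = idx) ->
  \big[op/idx]_j F j (spread (l, m) j) = \big[op/idx]_(i < d) F (l i) (m i).
Proof.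
move=> linj mpos F0.
rewrite (bigID (mem (l @: 'I_d))) /= [X in op _ X]big1 ?Monoid.mulm1 => [|j].
  rewrite big_imset => [|i j _ _ /linj //]; apply: eq_bigr => i _.
  by rewrite spreadE.
by rewrite -(supp_spread linj mpos) inE lt0n negbK => /eqP ->.
Qed.

Lemma weight_spread l m : increasing_pos l -> all_pos m ->
  weight (spread (l, m)) = wsum l m.
Proof.
move=> /increasing_pos_inj linj mpos.
exact: (@big_spread _ 0%N addn l m (fun j e => (e * j)%N)).
Qed.

Lemma mdegree_spread l m : increasing_pos l -> all_pos m ->
  mdegree (spread (l, m)) = sum_mults m.
Proof.
move=> /increasing_pos_inj linj mpos.
exact: (@big_spread _ 0%N addn l m (fun _ e => e)).
Qed.

Lemma sum_increasing (V : nmodType) (n : nat)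
    (F : {ffun 'I_k.+1 -> 'I_k.+2} -> V) :
  \sum_(l : {ffun 'I_d -> 'I_k.+1} | increasing_pos l)
    \sum_(m : {ffun 'I_d -> 'I_k.+2} | all_pos m && (wsum l m <= n)%N)
      F (spread (l, m)) =
  \sum_(M : {ffun 'I_k.+1 -> 'I_k.+2} | (M ord0 == ord0) && (weight M <= n)%N && (#|supp M| == d)) F M.
Proof.
rewrite pair_big_dep /= (reindex_onto gather spread); last first.
  by move=> [l m] /= /and3P[linc mpos _]; exact: spreadK.
apply: eq_big => M; case E: (gather M) => [l m] /=; last by case/andP=> _ /eqP ->.
apply/idP/idP => [/andP[/and3P[linc mpos w] /eqP <-]|/andP[/andP[/eqP M0 w] /eqP sd]].
  have linj := increasing_pos_inj linc.
  rewrite weight_spread // w supp_spread // card_imset // card_ord eqxx !andbT ffunE.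
  case: pickP => // i /= /eqP l0; have /andP[/forallP/(_ i)] := linc.
  by rewrite l0.
have [] := gatherP M0 sd; rewrite E /= => linc mpos sE.
by rewrite linc mpos sE eqxx andbT /= -weight_spread // sE.
Qed.

End Multiplicities.

(** * Assembly of the explicit formula *)

Definition taylor_coef (K : numFieldType) (k : nat) (z : jet K k) (i : 'I_k.+1) : K :=
  if i == ord0 then 0 else jy z i / (i`!)%:R.

Definition taylor_monomial (K : numFieldType) (k : nat) (z : jet K k)
    (M : {ffun 'I_k.+1 -> 'I_k.+2}) : K :=
  \prod_i (((M i)`!)%:R^-1 * taylor_coef z i ^+ M i).

Lemma taylor_expn (K : numFieldType) (k w s : nat) (z : jet K k) : (s < k.+2)%N ->
  (s`!)%:R^-1 * (taylor z ^+ s)`_w =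
  \sum_(M : {ffun 'I_k.+1 -> 'I_k.+2} | (weight M == w) && (mdegree M == s))
    taylor_monomial z M.
Proof.
move=> sk.
have -> : taylor z = \sum_i (taylor_coef z i)%:P * 'X^i.
  rewrite /taylor poly_def; apply: eq_bigr => i _.
  by rewrite mul_polyC /taylor_coef /jcoord inord_val -val_eqE.
rewrite -coefCM (multinomial _ sk) coef_sum [RHS]big_mkcondl; apply: eq_bigr => M _.
have -> : \prod_i (((M i)`!)%:R^-1%:P * ((taylor_coef z i)%:P * 'X^i) ^+ M i)
    = (taylor_monomial z M)%:P * 'X^(weight M).
  rewrite rmorph_prod /= /weight expr_sum -big_split; apply: eq_bigr => i _ /=.
  by rewrite exprMn polyCM polyC_exp mulrA -exprM mulnC.
by rewrite coefCM coefXn eq_sym; case: eqP => _; rewrite ?mulr1 ?mulr0.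
Qed.

(** A multiplicity function enters the coefficient only through its weight w and degree s. At w = 0
    the factor w removes the X term, whatever [w.-1] is. *)
Definition prolong_coef (K : numFieldType) (k : nat) (X Y : K * K -> K)
    (z : jet K k) (w s : nat) : K :=
  (k ^_ w)%:R * jpd Y z (k - w) s - (k ^_ w.-1 * w)%:R * jpd X z (k.+1 - w) s.-1.

Lemma prolong_sum (K : numFieldType) (X Y : K * K -> K) (k : nat) (z : jet K k) :
  real_or_complex K -> smooth X -> smooth Y ->
  prolong X Y k z = \sum_(w < k.+2) \sum_(s < k.+2)
    prolong_coef X Y z w s * ((s`!)%:R^-1 * (taylor z ^+ s)`_w).
Proof.
move=> hK sX sY; rewrite (prolong_faa z hK sX sY (leqnn k)).
set g := taylor z; have g0 : g`_0 = 0 := coef0_taylor z.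
pose e s w : K := (s`!)%:R^-1 * (g ^+ s)`_w.
have e0 s w : (w < s)%N -> e s w = 0.
  by move=> ws; rewrite /e -[g ^+ s]mul1r coefMX_lt // mulr0.
(* The enlarged ranges add only zeros: [k ^_ k.+1] vanishes, and so does the coefficient of t^w in
   g^(k+1) for w <= k. *)
have -> : faa k.+1 k (jpd Y z) 1 g = \sum_(w < k.+2) \sum_(s < k.+2)
    (k ^_ w)%:R * jpd Y z (k - w) s * e s w.
  rewrite [RHS]big_ord_recr /= [X in _ + X]big1 ?addr0 => [|s _]; last first.
    by rewrite ffact_small // !mul0r.
  apply: eq_bigr => w _; rewrite [RHS]big_ord_recr /= e0 // mulr0 addr0.
  by apply: eq_bigr => s _; rewrite /e mul1r; ring.
have -> : faa k.+1 k (jpd X z) g^`() g = \sum_(w < k.+2) \sum_(s < k.+2)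
    (k ^_ w.-1 * w)%:R * jpd X z (k.+1 - w) s.-1 * e s w.
  rewrite [RHS]big_ord_recl /= [X in X + _]big1 ?add0r => [|s _]; last first.
    by rewrite muln0 !mul0r.
  apply: eq_bigr => w _; rewrite [RHS]big_ord_recl /= /bump /= add1n.
  rewrite {1}/e expr0 coefC /= !mulr0 add0r; apply: eq_bigr => s _.
  rewrite add1n subSS /= /e factS !natrM invfM.
  (* Since g' g^s is the derivative of g^(s+1) / (s+1), the X part shifts both w and s by one; this
     is the origin of the factor w in its coefficient. *)
  have -> : (g ^+ s.+1)`_w.+1 = s.+1%:R * (g^`() * g ^+ s)`_w / w.+1%:R.
    apply: (canRL (mulfK _)); first by rewrite pnatr_eq0.
    by rewrite mulr_natr -coef_deriv deriv_exp /= coefMn mulr_natl.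
  by field; rewrite -!mulrS !pnatr_eq0 -!lt0n fact_gt0.
rewrite -sumrB; apply: eq_bigr => w _; rewrite -sumrB; apply: eq_bigr => s _.
by rewrite -mulrBl.
Qed.

Lemma mdegree_le_weight (k : nat) (M : {ffun 'I_k.+1 -> 'I_k.+2}) :
  M ord0 = ord0 -> (mdegree M <= weight M)%N.
Proof.
move=> M0; apply: leq_sum => j _; have [->|j0] := eqVneq j ord0; first by rewrite M0.
by rewrite leq_pmulr // lt0n.
Qed.

Lemma prolong_multiplicities (K : numFieldType) (X Y : K * K -> K) (k : nat)
    (z : jet K k) : real_or_complex K -> smooth X -> smooth Y ->
  prolong X Y k z =
  \sum_(M : {ffun 'I_k.+1 -> 'I_k.+2} | (M ord0 == ord0) && (weight M <= k.+1)%N)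
    prolong_coef X Y z (weight M) (mdegree M) * taylor_monomial z M.
Proof.
move=> hK sX sY; rewrite prolong_sum //.
transitivity (\sum_(w < k.+2) \sum_(s < k.+2)
    \sum_(M : {ffun 'I_k.+1 -> 'I_k.+2} | (weight M == w) && (mdegree M == s))
      prolong_coef X Y z w s * taylor_monomial z M).
  by apply: eq_bigr => w _; apply: eq_bigr => s _; rewrite taylor_expn // mulr_sumr.
under eq_bigr => w _ do rewrite (sum_fiber _ _ _
  (fun s M => prolong_coef X Y z w s * taylor_monomial z M)).
under eq_bigr => w _ do under eq_bigl do rewrite andbC.
rewrite (sum_fiber _ _ _
  (fun w M => prolong_coef X Y z w (mdegree M) * taylor_monomial z M)).
rewrite big_mkcond [RHS]big_mkcond; apply: eq_bigr => M _.
(* If M is nonzero at index 0, its monomial contains a power of the constant coefficient of g, which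
   is 0. Otherwise the degree is at most the weight, so the bound on s is automatic. *)
have [M0|M0] := eqVneq (M ord0) ord0; last first.
  rewrite /taylor_monomial (bigD1 ord0) //= /taylor_coef eqxx expr0n.
  by rewrite [_ == 0%N](negbTE M0) mulr0 mul0r mulr0 if_same.
rewrite ltnS [(weight M < _)%N]ltnS /= andbC; case: leqP => //= wk.
by rewrite (leq_trans (mdegree_le_weight M0)).
Qed.

Lemma taylor_monomial_spread (K : numFieldType) (k d : nat) (z : jet K k)
    (l : {ffun 'I_d -> 'I_k.+1}) (m : {ffun 'I_d -> 'I_k.+2}) :
  increasing_pos l -> all_pos m ->
  taylor_monomial z (spread (l, m)) =
  (\prod_(i < d) jy z (l i) ^+ m i) / (denom l m)%:R.
Proof.
move=> linc mpos; rewrite /taylor_monomial.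
rewrite (@big_spread _ _ _ 1 *%R l m
  (fun j e => ((e`!)%:R^-1 * taylor_coef z j ^+ e))) //; last first.
- by move=> j; rewrite expr0 fact0 invr1 mulr1.
- exact: increasing_pos_inj.
rewrite /denom natr_prod -prodf_div; apply: eq_bigr => i _.
rewrite /taylor_coef ifN; last first.
  by have /andP[/forallP/(_ i) + _] := linc; rewrite lt0n.
by rewrite natrM natrX expr_div_n invfM mulrC mulrA.
Qed.

(* The bound m i < k.+2 on the multiplicities is no restriction, since
   l i >= 1 and wsum l m <= k.+1. When wsum l m = k.+1, k - wsum l m truncates
   to 0 but its coefficient k ^_ (k.+1) is 0. *)
Theorem theorem2p24 (K : numFieldType) (hK : real_or_complex K)
    (X Y : K * K -> K) (hX : smooth X) (hY : smooth Y)
    (k : nat) (hk : (1 <= k)%N) (z : jet K k) :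
  prolong X Y k z =
    pdxy k 0 Y (jx z, jy z ord0) +
    \sum_(1 <= d < k.+2)
     \sum_(l : {ffun 'I_d -> 'I_k.+1} | increasing_pos l)
      \sum_(m : {ffun 'I_d -> 'I_k.+2} | all_pos m && (wsum l m <= k.+1)%N)
       ((k ^_ (wsum l m))%:R / (denom l m)%:R
          * pdxy (k - wsum l m) (sum_mults m) Y (jx z, jy z ord0)
        - (k ^_ (wsum l m).-1 * wsum l m)%:R / (denom l m)%:R
          * pdxy (k.+1 - wsum l m) (sum_mults m).-1 X (jx z, jy z ord0))
       * \prod_(i < d) jy z (l i) ^+ m i.
Proof.
pose F (M : {ffun 'I_k.+1 -> 'I_k.+2}) :=
  prolong_coef X Y z (weight M) (mdegree M) * taylor_monomial z M.
pose P (M : {ffun 'I_k.+1 -> 'I_k.+2}) := (M ord0 == ord0) && (weight M <= k.+1)%N.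
(* The multiplicity functions are sorted by the size d of their support, at most k + 1. *)
transitivity (\sum_(0 <= d < k.+2) \sum_(M | P M && (#|supp M| == d)) F M).
  rewrite prolong_multiplicities // big_mkord.
  rewrite (sum_fiber P (fun M => #|supp M|) _ (fun=> F)); apply: eq_bigl => M.
  have -> : (#|supp M| < k.+2)%N by rewrite ltnS -[X in (_ <= X)%N]card_ord max_card.
  by rewrite andbT.
(* For d = 0 only the zero function occurs, and it gives the isolated term Y_{x^k}. *)
rewrite big_ltn //; congr (_ + _).
  pose M0 : {ffun 'I_k.+1 -> 'I_k.+2} := [ffun=> ord0].
  have w0 : weight M0 = 0%N by rewrite /weight big1 // => j _; rewrite ffunE.
  have d0 : mdegree M0 = 0%N by rewrite /mdegree big1 // => j _; rewrite ffunE.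
  rewrite (big_pred1 M0) => [|M].
    rewrite /F w0 d0 /prolong_coef muln0 mul0r subr0 ffactn0 mul1r subn0.
    rewrite /taylor_monomial big1 ?mulr1 // => j _.
    by rewrite ffunE expr0 fact0 invr1 mulr1.
  apply/idP/eqP => [/andP[_]|->].
    rewrite cards_eq0 => /eqP s0; apply/ffunP => j; rewrite ffunE; apply: val_inj.
    have : j \notin supp M by rewrite s0 inE.
    by rewrite inE lt0n negbK => /eqP.
  rewrite /P ffunE eqxx w0 /= cards_eq0; apply/eqP/setP => j.
  by rewrite !inE ffunE.
apply: eq_bigr => d _; rewrite -sum_increasing; apply: eq_bigr => l linc.
apply: eq_bigr => m /andP[mpos _].
rewrite /F /prolong_coef weight_spread // mdegree_spread // taylor_monomial_spread //.
rewrite /jpd /plane; ring.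
Qed.
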